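(* Let $c_1,c_2>0$ be constants and let $b^{(1)}_{2,p,q}$, $b^{(2)}_{2,p,q}$, $b_{2,p,q}$ and $\widehat b_{2,p,q}$ be the statistics defined in the context from the two-step monotone incomplete data $(X_1,Y_1),\ldots,(X_n,Y_n),Y_{n+1},\ldots,Y_N$. Then: (i) The statistics $b^{(1)}_{2,p,q}$, $b^{(2)}_{2,p,q}$ and $b_{2,p,q}$ are invariant under every transformation of the data of the form $$\binom{X_j}{Y_j}\ \to\ \Lambda C\binom{X_j}{Y_j}+\nu\quad (j=1,\ldots,n),\qquad Y_j\ \to\ \Lambda_{22}Y_j+\nu_2\quad (j=n+1,\ldots,N),$$ where $$\Lambda=\begin{pmatrix}\Lambda_{11}&0\\0&\Lambda_{22}\end{pmatrix},\qquad C=\begin{pmatrix}I_p&\Lambda_{12}\\0&I_q\end{pmatrix},\qquad \nu=\binom{\nu_1}{\nu_2},$$ with $\Lambda_{11}$ ($p\times p$) and $\Lambda_{22}$ ($q\times q$) symmetric positive definite matrices, $\Lambda_{12}$ any $p\times q$ matrix, and $\nu_1\in\mathbb{R}^p$, $\nu_2\in\mathbb{R}^q$ any vectors. That is, each of these statistics computed from the transformed data equals the same statistic computed from the original data. (ii) $b_{2,p,q}=\widehat b_{2,p,q}$ identically.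
   Context: The data are two-step monotone incomplete: $X_j\in\mathbb{R}^p$ for $1\le j\le n$ and $Y_j\in\mathbb{R}^q$ for $1\le j\le N$, where $n<N$ (so $X_j$ is missing for $j>n$). Put $Z_j=\binom{X_j}{Y_j}$ for $1\le j\le n$, $\tau=n/N$ and $\bar\tau=1-\tau=(N-n)/N$. A prime denotes transpose and $I_d$ is the $d\times d$ identity matrix. Sample means: $\bar X=\frac1n\sum_{j=1}^nX_j$, $\bar Y_1=\frac1n\sum_{j=1}^nY_j$, $\bar Y_2=\frac1{N-n}\sum_{j=n+1}^NY_j$, $\bar Y=\frac1N\sum_{j=1}^NY_j$. Sums of squares and products: $A_{11}=\sum_{j=1}^n(X_j-\bar X)(X_j-\bar X)'$, $A_{12}=A_{21}'=\sum_{j=1}^n(X_j-\bar X)(Y_j-\bar Y_1)'$, $A_{22,n}=\sum_{j=1}^n(Y_j-\bar Y_1)(Y_j-\bar Y_1)'$, $A_{22,N}=\sum_{j=1}^N(Y_j-\bar Y)(Y_j-\bar Y)'$, $A_{11\cdot2,n}=A_{11}-A_{12}A_{22,n}^{-1}A_{21}$. All matrices that are inverted are understood to be nonsingular. Estimators: $\widehat\mu=\binom{\widehat\mu_1}{\widehat\mu_2}$ with $\widehat\mu_1=\bar X-\bar\tau A_{12}A_{22,n}^{-1}(\bar Y_1-\bar Y_2)$ and $\widehat\mu_2=\bar Y$; and $\widehat\Sigma=\begin{pmatrix}\widehat\Sigma_{11}&\widehat\Sigma_{12}\\\widehat\Sigma_{21}&\widehat\Sigma_{22}\end{pmatrix}$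 with $\widehat\Sigma_{11}=\frac1nA_{11\cdot2,n}+\frac1NA_{12}A_{22,n}^{-1}A_{22,N}A_{22,n}^{-1}A_{21}$, $\widehat\Sigma_{12}=\widehat\Sigma_{21}'=\frac1NA_{12}A_{22,n}^{-1}A_{22,N}$, $\widehat\Sigma_{22}=\frac1NA_{22,N}$. Statistics: $$b^{(1)}_{2,p,q}=\sum_{j=1}^n\big[(Z_j-\widehat\mu)'\widehat\Sigma^{-1}(Z_j-\widehat\mu)\big]^2,\qquad b^{(2)}_{2,p,q}=\sum_{j=n+1}^N\big[(Y_j-\widehat\mu_2)'\widehat\Sigma_{22}^{-1}(Y_j-\widehat\mu_2)\big]^2,$$ $$b_{2,p,q}=\frac1N\big(c_1b^{(1)}_{2,p,q}+c_2b^{(2)}_{2,p,q}\big).$$ For $j=n+1,\ldots,N$ the regression-imputed vectors are $\widehat X_j=\widehat\mu_1+\widehat\Sigma_{12}\widehat\Sigma_{22}^{-1}(Y_j-\widehat\mu_2)$, and $$\widehat b_{2,p,q}=\frac1N\Big\{c_1\sum_{j=1}^n\big[(Z_j-\widehat\mu)'\widehat\Sigma^{-1}(Z_j-\widehat\mu)\big]^2+c_2\sum_{j=n+1}^N\Big[\Big(\tbinom{\widehat X_j}{Y_j}-\widehat\mu\Big)'\widehat\Sigma^{-1}\Big(\tbinom{\widehat X_j}{Y_j}-\widehat\mu\Big)\Big]^2\Big\}.$$ *)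

(* Defs.v *)
From HB Require Import structures.
From mathcomp Require Import all_boot all_order all_algebra.
From mathcomp Require Import reals.

Set Implicit Arguments.
Unset Strict Implicit.
Unset Printing Implicit Defensive.

Import Order.TTheory GRing.Theory Num.Theory.
Local Open Scope ring_scope.

Definition sym_posdef (R : realType) (d : nat) (M : 'M[R]_d) : Prop :=
  M^T = M /\ forall u : 'cV[R]_d, u != 0 -> 0 < (u^T *m M *m u) 0 0.

Definition invquad (R : realType) (d : nat) (S : 'M[R]_d) (v : 'cV[R]_d) : R :=
  (v^T *m invmx S *m v) 0 0.

Section TwoStepMonotone.

Variables (R : realType) (p q n N : nat) (ltnN : (n < N)%N).
(* Indices start at 0: X_j is observed for j < n and missing for n <= j < N. *)
Variables (X : 'I_n -> 'cV[R]_p) (Y : 'I_N -> 'cV[R]_q).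

Definition Yc (j : 'I_n) : 'cV[R]_q := Y (widen_ord (ltnW ltnN) j).
Definition Z (j : 'I_n) : 'cV[R]_(p + q) := col_mx (X j) (Yc j).

Definition tau : R := n%:R / N%:R.
Definition taubar : R := 1 - tau.

Definition Xbar : 'cV[R]_p := n%:R^-1 *: \sum_(j < n) X j.
Definition Ybar1 : 'cV[R]_q := n%:R^-1 *: \sum_(j < n) Yc j.
Definition Ybar2 : 'cV[R]_q :=
  (N - n)%:R^-1 *: \sum_(j < N | (n <= j)%N) Y j.
Definition Ybar : 'cV[R]_q := N%:R^-1 *: \sum_(j < N) Y j.

Definition A11 : 'M[R]_p := \sum_(j < n) (X j - Xbar) *m (X j - Xbar)^T.
Definition A12 : 'M[R]_(p, q) := \sum_(j < n) (X j - Xbar) *m (Yc j - Ybar1)^T.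
Definition A21 : 'M[R]_(q, p) := A12^T.
Definition A22n : 'M[R]_q := \sum_(j < n) (Yc j - Ybar1) *m (Yc j - Ybar1)^T.
Definition A22N : 'M[R]_q := \sum_(j < N) (Y j - Ybar) *m (Y j - Ybar)^T.
Definition A112n : 'M[R]_p := A11 - A12 *m invmx A22n *m A21.

Definition muhat1 : 'cV[R]_p :=
  Xbar - taubar *: (A12 *m invmx A22n *m (Ybar1 - Ybar2)).
Definition muhat2 : 'cV[R]_q := Ybar.
Definition muhat : 'cV[R]_(p + q) := col_mx muhat1 muhat2.

Definition Sigmahat11 : 'M[R]_p :=
  n%:R^-1 *: A112n
  + N%:R^-1 *: (A12 *m invmx A22n *m A22N *m invmx A22n *m A21).
Definition Sigmahat12 : 'M[R]_(p, q) :=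
  N%:R^-1 *: (A12 *m invmx A22n *m A22N).
Definition Sigmahat21 : 'M[R]_(q, p) := Sigmahat12^T.
Definition Sigmahat22 : 'M[R]_q := N%:R^-1 *: A22N.
Definition Sigmahat : 'M[R]_(p + q) :=
  block_mx Sigmahat11 Sigmahat12 Sigmahat21 Sigmahat22.

Definition b1 : R := \sum_(j < n) invquad Sigmahat (Z j - muhat) ^+ 2.
Definition b2 : R :=
  \sum_(j < N | (n <= j)%N) invquad Sigmahat22 (Y j - muhat2) ^+ 2.
Definition b (c1 c2 : R) : R := N%:R^-1 * (c1 * b1 + c2 * b2).

Definition Xhat (j : 'I_N) : 'cV[R]_p :=
  muhat1 + Sigmahat12 *m invmx Sigmahat22 *m (Y j - muhat2).
Definition bhat (c1 c2 : R) : R :=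
  N%:R^-1 *
  (c1 * (\sum_(j < n) invquad Sigmahat (Z j - muhat) ^+ 2)
   + c2 * (\sum_(j < N | (n <= j)%N)
             invquad Sigmahat (col_mx (Xhat j) (Y j) - muhat) ^+ 2)).

End TwoStepMonotone.

Definition Lambda (R : realType) (p q : nat) (L11 : 'M[R]_p) (L22 : 'M[R]_q)
    : 'M[R]_(p + q) :=
  block_mx L11 0 0 L22.

Definition Cmx (R : realType) (p q : nat) (L12 : 'M[R]_(p, q))
    : 'M[R]_(p + q) :=
  block_mx 1%:M L12 0 1%:M.

(* X', Y' are the transformed data.  For j < n the transformed Y_j is the lower
   block of Lambda C Z_j + nu, which the first conjunct determines. *)
Definition transformed (R : realType) (p q n N : nat) (ltnN : (n < N)%N)
    (L11 : 'M[R]_p) (L22 : 'M[R]_q) (L12 : 'M[R]_(p, q))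
    (nu1 : 'cV[R]_p) (nu2 : 'cV[R]_q)
    (X : 'I_n -> 'cV[R]_p) (Y : 'I_N -> 'cV[R]_q)
    (X' : 'I_n -> 'cV[R]_p) (Y' : 'I_N -> 'cV[R]_q) : Prop :=
  (forall j : 'I_n,
     Z ltnN X' Y' j
     = Lambda L11 L22 *m Cmx L12 *m Z ltnN X Y j + col_mx nu1 nu2)
  /\ (forall j : 'I_N, (n <= j)%N -> Y' j = L22 *m Y j + nu2).

(* Main.v *)
Require Import Defs.
From HB Require Import structures.
From mathcomp Require Import all_boot all_order all_algebra.
From mathcomp Require Import reals.

Set Implicit Arguments.
Unset Strict Implicit.
Unset Printing Implicit Defensive.

Import Order.TTheory GRing.Theory Num.Theory.
Local Open Scope ring_scope.

(** Let [B = A12 A22n^-1] be the sample regression coefficient.  Then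
    [Sigmahat = U diag (n^-1 A112n, Sigmahat22) U^T] with
    [U = block_mx 1 B 0 1], and, since [taubar (Ybar1 - Ybar2) = Ybar1 - Ybar],
    [muhat1 = Xbar - B (Ybar1 - Ybar)].  An affine map with linear part
    [M = block_mx L11 K 0 L22] sends [B] to [(L11 B + K) L22^-1] and [A112n] to
    [L11 A112n L11^T], so it sends [muhat] to [M muhat + nu] and [Sigmahat] to
    [M Sigmahat M^T]; the quadratic forms are therefore unchanged.
    For the imputed vectors, [Sigmahat] maps [col_mx 0 (Sigmahat22^-1 y)] to
    [col_mx (Sigmahat12 Sigmahat22^-1 y) y], which reduces the quadratic form of
    the completed vector to that of [y]. *)

(** * Quadratic forms in an inverse matrix, and means of shifted data *)

Lemma sym_posdef_unit (R : realType) d (M : 'M[R]_d) :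
  sym_posdef M -> M \in unitmx.
Proof.
case=> _ posM; rewrite -row_free_unit -kermx_eq0.
apply/rowV0P => v /sub_kermxP vM0; apply/eqP/negP => /negP v_neq0.
have := posM v^T; rewrite trmxK vM0 mul0mx mxE ltxx.
by move=> H; suff: false by []; apply: H; rewrite trmx_eq0.
Qed.

(** Evaluates a form from an exhibited solution of a linear system, so no block formula for
    [invmx S] is ever expanded. *)
Lemma invquad_solve (R : realType) d (S : 'M[R]_d) (v w : 'cV[R]_d) :
  S \in unitmx -> S *m w = v -> invquad S v = (v^T *m w) 0 0.
Proof. by move=> uS <-; rewrite /invquad -mulmxA mulKmx. Qed.

Lemma invquad_congr (R : realType) d (M S : 'M[R]_d) (v : 'cV[R]_d) :
  M \in unitmx -> S \in unitmx ->
  invquad (M *m S *m M^T) (M *m v) = invquad S v.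
Proof.
move=> uM uS; have uMT : M^T \in unitmx by rewrite unitmx_tr.
rewrite (@invquad_solve _ _ _ _ (invmx M^T *m (invmx S *m v))).
- by rewrite trmx_mul -!mulmxA mulKVmx // /invquad mulmxA.
- by rewrite !unitmx_mul uM uS uMT.
by rewrite -!mulmxA mulKVmx // mulKVmx.
Qed.

Lemma subrDD (V : zmodType) (z x y : V) : (x + z) - (y + z) = x - y.
Proof. by rewrite [y + z]addrC addrKA. Qed.

Lemma mean_addc (R : realType) d m (u : 'I_m -> 'cV[R]_d) (nu : 'cV[R]_d) :
  (0 < m)%N ->
  m%:R^-1 *: \sum_(j < m) (u j + nu) = m%:R^-1 *: (\sum_(j < m) u j) + nu.
Proof.
move=> m_gt0; rewrite big_split /= scalerDr sumr_const card_ord -scaler_nat.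
by rewrite scalerA mulVf ?scale1r // pnatr_eq0 -lt0n.
Qed.

(** * Algebra of the estimators for a fixed sample *)

Section MonotoneSample.

Variables (R : realType) (p q n N : nat) (n_gt0 : (0 < n)%N) (ltnN : (n < N)%N).

Definition regcoef (X : 'I_n -> 'cV[R]_p) (Y : 'I_N -> 'cV[R]_q) : 'M[R]_(p, q) :=
  A12 ltnN X Y *m invmx (A22n ltnN Y).

Lemma trmx_A22n (Y : 'I_N -> 'cV[R]_q) : (A22n ltnN Y)^T = A22n ltnN Y.
Proof.
by rewrite /A22n linear_sum; apply: eq_bigr => j _; rewrite /= trmx_mul trmxK.
Qed.

Lemma trmx_A22N (Y : 'I_N -> 'cV[R]_q) : (A22N Y)^T = A22N Y.
Proof.
by rewrite /A22N linear_sum; apply: eq_bigr => j _; rewrite /= trmx_mul trmxK.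
Qed.

Lemma A21E (X : 'I_n -> 'cV[R]_p) (Y : 'I_N -> 'cV[R]_q) :
  A21 ltnN X Y
  = \sum_(j < n) (Yc ltnN Y j - Ybar1 ltnN Y) *m (X j - Xbar X)^T.
Proof.
by rewrite /A21 linear_sum; apply: eq_bigr => j _; rewrite /= trmx_mul trmxK.
Qed.

Lemma trmx_regcoef X Y :
  (regcoef X Y)^T = invmx (A22n ltnN Y) *m A21 ltnN X Y.
Proof. by rewrite /regcoef trmx_mul trmx_inv trmx_A22n. Qed.

(** Block elimination of [Sigmahat22], with Schur complement [n^-1 A112n]; each factor has a simple
    affine transformation law. *)
Lemma SigmahatE X Y (U := block_mx 1%:M (regcoef X Y) 0 1%:M) :
  Sigmahat ltnN X Y
  = U *m block_mx (n%:R^-1 *: A112n ltnN X Y) 0 0 (Sigmahat22 Y) *m U^T.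
Proof.
rewrite /U tr_block_mx !mulmx_block !trmx1 !trmx0.
rewrite !(mul0mx, mulmx0, mul1mx, mulmx1, addr0, add0r).
rewrite /Sigmahat /Sigmahat21 /Sigmahat11 /Sigmahat12 /Sigmahat22.
congr block_mx.
- by rewrite trmx_regcoef /regcoef -scalemxAr -scalemxAl !mulmxA.
- by rewrite -scalemxAr.
by rewrite linearZ /= trmx_mul trmx_A22N -scalemxAl.
Qed.

(** Trading [Ybar2] for [Ybar] leaves only means over all of ['I_n] or ['I_N], to which [mean_addc]
    applies. *)
Lemma scale_Ybar_diff (Y : 'I_N -> 'cV[R]_q) :
  taubar R n N *: (Ybar1 ltnN Y - Ybar2 n Y) = Ybar1 ltnN Y - Ybar Y.
Proof.
have n_neq0 : n%:R != 0 :> R by rewrite pnatr_eq0 -lt0n.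
have N_neq0 : N%:R != 0 :> R by rewrite pnatr_eq0 -lt0n (leq_trans n_gt0) // ltnW.
have Nn_neq0 : (N - n)%:R != 0 :> R by rewrite pnatr_eq0 subn_eq0 -ltnNge.
have tauE : taubar R n N = (N - n)%:R / N%:R.
  by rewrite /taubar /tau natrB 1?ltnW // mulrBl divff.
have tauE' : 1 - taubar R n N = n%:R / N%:R.
  by rewrite /taubar opprB addrC subrK.
(* The pooled mean is the average of the two group means, weighted by group size. *)
suff -> : Ybar Y = (1 - taubar R n N) *: Ybar1 ltnN Y + taubar R n N *: Ybar2 n Y.
  move: (taubar R n N) => t.
  by rewrite scalerBl scale1r scalerBr opprD opprB addrA addrCA subrr addr0.
rewrite tauE' tauE /Ybar /Ybar1 /Ybar2 !scalerA.
rewrite [n%:R / _]mulrC [(N - n)%:R / _]mulrC !mulfK // -scalerDr.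
rewrite (bigID (fun j : 'I_N => (n <= j)%N)) /= addrC; congr (_ *: (_ + _)).
under eq_bigl => j do rewrite -ltnNge.
by rewrite (big_ord_narrow (ltnW ltnN)).
Qed.

Lemma muhat1E X Y :
  muhat1 ltnN X Y = Xbar X - regcoef X Y *m (Ybar1 ltnN Y - Ybar Y).
Proof. by rewrite /muhat1 scalemxAr scale_Ybar_diff. Qed.

(** An imputed vector has zero regression residual, so only its [Y] part contributes to the form. *)
Lemma invquad_imputed (X : 'I_n -> 'cV[R]_p) (Y : 'I_N -> 'cV[R]_q) j :
  Sigmahat22 Y \in unitmx -> Sigmahat ltnN X Y \in unitmx ->
  invquad (Sigmahat ltnN X Y) (col_mx (Xhat ltnN X Y j) (Y j) - muhat ltnN X Y)
  = invquad (Sigmahat22 Y) (Y j - muhat2 Y).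
Proof.
move=> uS22 uS; rewrite /muhat opp_col_mx add_col_mx.
rewrite (invquad_solve
  (w := col_mx 0 (invmx (Sigmahat22 Y) *m (Y j - muhat2 Y)))) //.
  by rewrite tr_col_mx mul_row_col mulmx0 add0r mulmxA.
rewrite mul_block_col !mulmx0 !add0r mulKVmx // mulmxA.
by rewrite /Xhat [muhat1 _ _ _ + _]addrC addrK.
Qed.

(** * Equivariance of the estimators under a block triangular affine map *)

Section AffineTransform.

Variables (L11 : 'M[R]_p) (K : 'M[R]_(p, q)) (L22 : 'M[R]_q).
Variables (nu1 : 'cV[R]_p) (nu2 : 'cV[R]_q).
Variables (X X' : 'I_n -> 'cV[R]_p) (Y Y' : 'I_N -> 'cV[R]_q).
Hypotheses (uL11 : L11 \in unitmx) (uL22 : L22 \in unitmx).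
Hypothesis uA22n : A22n ltnN Y \in unitmx.
Hypothesis X'E : forall j, X' j = L11 *m X j + K *m Yc ltnN Y j + nu1.
Hypothesis Y'E : forall j, Y' j = L22 *m Y j + nu2.

Let M : 'M[R]_(p + q) := block_mx L11 K 0 L22.

Lemma Xbar_affine : Xbar X' = L11 *m Xbar X + K *m Ybar1 ltnN Y + nu1.
Proof.
rewrite /Xbar (eq_bigr _ (fun j _ => X'E j)) mean_addc // big_split /=.
by rewrite -!mulmx_sumr scalerDr !scalemxAr.
Qed.

Lemma Ybar1_affine : Ybar1 ltnN Y' = L22 *m Ybar1 ltnN Y + nu2.
Proof.
rewrite /Ybar1 (eq_bigr _ (fun j _ => Y'E _)) mean_addc //.
by rewrite -mulmx_sumr scalemxAr.
Qed.

Lemma Ybar_affine : Ybar Y' = L22 *m Ybar Y + nu2.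
Proof.
rewrite /Ybar (eq_bigr _ (fun j _ => Y'E j)).
rewrite mean_addc ?(leq_trans n_gt0 (ltnW ltnN)) //.
by rewrite -mulmx_sumr scalemxAr.
Qed.

Lemma centered_X_affine j :
  X' j - Xbar X' = L11 *m (X j - Xbar X) + K *m (Yc ltnN Y j - Ybar1 ltnN Y).
Proof.
by rewrite X'E Xbar_affine subrDD opprD addrACA -!mulmxBr.
Qed.

Lemma centered_Yc_affine j :
  Yc ltnN Y' j - Ybar1 ltnN Y' = L22 *m (Yc ltnN Y j - Ybar1 ltnN Y).
Proof. by rewrite /Yc Y'E Ybar1_affine subrDD -mulmxBr. Qed.

Lemma centered_Y_affine j : Y' j - Ybar Y' = L22 *m (Y j - Ybar Y).
Proof. by rewrite Y'E Ybar_affine subrDD -mulmxBr. Qed.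

Lemma A22n_affine : A22n ltnN Y' = L22 *m A22n ltnN Y *m L22^T.
Proof.
rewrite /A22n mulmx_sumr mulmx_suml; apply: eq_bigr => j _.
by rewrite centered_Yc_affine trmx_mul !mulmxA.
Qed.

Lemma A22N_affine : A22N Y' = L22 *m A22N Y *m L22^T.
Proof.
rewrite /A22N mulmx_sumr mulmx_suml; apply: eq_bigr => j _.
by rewrite centered_Y_affine trmx_mul !mulmxA.
Qed.

Lemma A12_affine :
  A12 ltnN X' Y' = (L11 *m A12 ltnN X Y + K *m A22n ltnN Y) *m L22^T.
Proof.
rewrite /A12 /A22n !mulmx_sumr -big_split mulmx_suml; apply: eq_bigr => j _ /=.
rewrite centered_X_affine centered_Yc_affine trmx_mul mulmxA.
by rewrite !mulmxA !mulmxDl.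
Qed.

Lemma A11_affine :
  A11 X' = L11 *m A11 X *m L11^T + L11 *m A12 ltnN X Y *m K^T
           + (K *m A21 ltnN X Y *m L11^T + K *m A22n ltnN Y *m K^T).
Proof.
rewrite A21E /A11 /A12 /A22n !mulmx_sumr !mulmx_suml -!big_split.
apply: eq_bigr => j _ /=; rewrite centered_X_affine.
move: (X j - _) (Yc _ _ _ - _) => x y.
by rewrite linearD /= !trmx_mul mulmxDl !mulmxDr !mulmxA.
Qed.

Lemma regcoef_affine : regcoef X' Y' *m L22 = L11 *m regcoef X Y + K.
Proof.
have uL22T : L22^T \in unitmx by rewrite unitmx_tr.
have uA : A22n ltnN Y' \in unitmx by rewrite A22n_affine !unitmx_mul uL22 uA22n.
(* Multiplying by [A22n *m L22^T] on the right completes [L22] to the transformed [A22n], which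
   cancels the inverse inside [regcoef X' Y']. *)
apply: (can_inj (mulmxK uA22n)); apply: (can_inj (mulmxK uL22T)).
rewrite -!mulmxA [L22 *m (_ *m _)]mulmxA -A22n_affine /regcoef mulVmx // mulmx1.
by rewrite A12_affine !mulmxA [in RHS]mulmxDl mulmxKV.
Qed.

Lemma A112n_affine : A112n ltnN X' Y' = L11 *m A112n ltnN X Y *m L11^T.
Proof.
rewrite /A112n -!/(regcoef _ _) A11_affine /A21 A12_affine.
rewrite trmx_mul trmxK mulmxA regcoef_affine linearD /= !trmx_mul trmx_A22n.
rewrite mulmxBr mulmxBl mulmxDl !mulmxDr !mulmxA.
(* Once [B *m A22n] is folded back to [A12], the same three terms in [K] occur in the new [A11] and
   in the subtracted product. *)
by rewrite mulmxKV // !subrDD.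
Qed.

Lemma muhat_affine : muhat ltnN X' Y' = M *m muhat ltnN X Y + col_mx nu1 nu2.
Proof.
rewrite /muhat mul_block_col mul0mx add0r add_col_mx /muhat2 Ybar_affine.
congr col_mx; rewrite !muhat1E Xbar_affine Ybar1_affine Ybar_affine subrDD.
(* The [K] part of the new coefficient turns the term [K *m Ybar1] of the new [Xbar] into
   [K *m Ybar], as [M] prescribes. *)
rewrite -mulmxBr mulmxA regcoef_affine mulmxDl !mulmxBr !mulmxA.
rewrite [in LHS]addrAC; congr (_ + _).
rewrite opprD addrACA; congr (_ + _).
exact: subKr.
Qed.

Lemma Sigmahat22_affine : Sigmahat22 Y' = L22 *m Sigmahat22 Y *m L22^T.
Proof. by rewrite /Sigmahat22 A22N_affine -scalemxAr -scalemxAl. Qed.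

Lemma Sigmahat_affine :
  Sigmahat ltnN X' Y' = M *m Sigmahat ltnN X Y *m M^T.
Proof.
(* [D] is the diagonal part of [M]. The middle factor is congruent by [D], and [U' D = M U] moves
   [D] outward to become [M]. *)
pose D : 'M[R]_(p + q) := block_mx L11 0 0 L22.
have UE : block_mx 1%:M (regcoef X' Y') 0 1%:M *m D
          = M *m block_mx 1%:M (regcoef X Y) 0 1%:M.
  rewrite !mulmx_block !(mul0mx, mulmx0, mul1mx, mulmx1, addr0, add0r).
  by rewrite regcoef_affine.
have DE : block_mx (n%:R^-1 *: A112n ltnN X' Y') 0 0 (Sigmahat22 Y')
    = D *m block_mx (n%:R^-1 *: A112n ltnN X Y) 0 0 (Sigmahat22 Y) *m D^T.
  rewrite tr_block_mx !trmx0 !mulmx_block.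
  rewrite !(mul0mx, mulmx0, mul1mx, mulmx1, addr0, add0r).
  rewrite A112n_affine Sigmahat22_affine; congr block_mx.
  by rewrite -scalemxAr -scalemxAl.
rewrite !SigmahatE DE !mulmxA UE -!mulmxA -trmx_mul UE.
by rewrite trmx_mul !mulmxA.
Qed.

Lemma b1_affine :
  Sigmahat ltnN X Y \in unitmx -> b1 ltnN X' Y' = b1 ltnN X Y.
Proof.
move=> uS; apply: eq_bigr => j _; congr (_ ^+ 2).
have uM : M \in unitmx by rewrite unitmxE det_ublock unitrM -!unitmxE uL11 uL22.
have ZE : Z ltnN X' Y' j = M *m Z ltnN X Y j + col_mx nu1 nu2.
  by rewrite /Z mul_block_col mul0mx add0r add_col_mx X'E /Yc Y'E.
by rewrite ZE muhat_affine subrDD -mulmxBr Sigmahat_affine invquad_congr.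
Qed.

Lemma b2_affine : Sigmahat22 Y \in unitmx -> b2 n Y' = b2 n Y.
Proof.
move=> uS; apply: eq_bigr => j _; congr (_ ^+ 2).
by rewrite /muhat2 centered_Y_affine Sigmahat22_affine invquad_congr.
Qed.

End AffineTransform.

End MonotoneSample.

(** Glues the complete and incomplete cases into one law for [Y']; multiplying out [Lambda] and
    [Cmx] gives [K = L11 *m L12]. *)
Lemma transformedE (R : realType) (p q n N : nat) (ltnN : (n < N)%N)
    (L11 : 'M[R]_p) (L22 : 'M[R]_q) (L12 : 'M[R]_(p, q)) nu1 nu2 X Y X' Y' :
  transformed ltnN L11 L22 L12 nu1 nu2 X Y X' Y' ->
  (forall j, X' j = L11 *m X j + L11 *m L12 *m Yc ltnN Y j + nu1)
  /\ (forall j, Y' j = L22 *m Y j + nu2).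
Proof.
case=> ZE YE.
have E j : X' j = L11 *m X j + L11 *m L12 *m Yc ltnN Y j + nu1
           /\ Yc ltnN Y' j = L22 *m Yc ltnN Y j + nu2.
  apply: eq_col_mx; have := ZE j; rewrite /Z => ->.
  rewrite /Lambda /Cmx mulmx_block mul_block_col add_col_mx.
  by rewrite !(mul0mx, mulmx0, mulmx1, addr0, add0r).
split=> j; first by have [] := E j.
case: (leqP n j) => [/YE // | ltjn].
have [_] := E (Ordinal ltjn); rewrite /Yc.
by rewrite (_ : widen_ord _ _ = j) //; apply: val_inj.
Qed.

Theorem theorem3p1 (R : realType) (p q n N : nat)
    (n_gt0 : (0 < n)%N) (ltnN : (n < N)%N)
    (c1 c2 : R) (c1_gt0 : 0 < c1) (c2_gt0 : 0 < c2)
    (X : 'I_n -> 'cV[R]_p) (Y : 'I_N -> 'cV[R]_q)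
    (A22n_unit : A22n ltnN Y \in unitmx)
    (Sigmahat22_unit : Sigmahat22 Y \in unitmx)
    (Sigmahat_unit : Sigmahat ltnN X Y \in unitmx) :
  (forall (L11 : 'M[R]_p) (L22 : 'M[R]_q) (L12 : 'M[R]_(p, q))
          (nu1 : 'cV[R]_p) (nu2 : 'cV[R]_q)
          (X' : 'I_n -> 'cV[R]_p) (Y' : 'I_N -> 'cV[R]_q),
     sym_posdef L11 -> sym_posdef L22 ->
     transformed ltnN L11 L22 L12 nu1 nu2 X Y X' Y' ->
     [/\ b1 ltnN X' Y' = b1 ltnN X Y,
         b2 n Y' = b2 n Y
       & b ltnN X' Y' c1 c2 = b ltnN X Y c1 c2])
  /\ b ltnN X Y c1 c2 = bhat ltnN X Y c1 c2.
Proof.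
split=> [L11 L22 L12 nu1 nu2 X' Y' /sym_posdef_unit uL11 /sym_posdef_unit uL22|].
  case/transformedE=> X'E Y'E.
  have b1E : b1 ltnN X' Y' = b1 ltnN X Y by exact: b1_affine X'E Y'E _.
  have b2E : b2 n Y' = b2 n Y by exact: (b2_affine n_gt0 ltnN uL22 Y'E).
  by split=> //; rewrite /b b1E b2E.
rewrite /b /bhat /b1 /b2; congr (_ * (_ + _ * _)).
by apply: eq_bigr => j _; rewrite invquad_imputed.
Qed.
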